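(* Let $G=(V,E)$ be a locally finite (unweighted) graph. Then for every function $f:V\to\mathbb{R}$ and every $x\in V$, the Laplace operator $\Delta$ satisfies $$\Gamma_2(f,f)(x)\geq\frac{1}{2}(\Delta f(x))^2+\left(\frac{1}{2}t(x)-1\right)\Gamma(f,f)(x),$$ where $$t(x):=\min_{y:\,y\sim x}\left(\frac{4}{d_y}+\frac{1}{D(x)}\sharp(x,y)\right).$$
   Context: Graphs $G=(V,E)$ are undirected, connected, simple, without loops; $V$ may be infinite; locally finite means every vertex has finitely many neighbors. $x\sim y$ means $x,y$ are neighbors, and $d_x$ is the degree (number of neighbors) of $x$. The Laplace operator is $\Delta f(x)=\frac{1}{d_x}\sum_{y:\,y\sim x}(f(y)-f(x))$. Further, $\Gamma(f,g)=\frac12\{\Delta(fg)-f\Delta g-g\Delta f\}$ and $\Gamma_2(f,g)=\frac12\{\Delta\Gamma(f,g)-\Gamma(f,\Delta g)-\Gamma(\Delta f,g)\}$. For $x\sim y$, $\sharp(x,y)$ is the number of triangles containing $x$ and $y$, i.e. the number of vertices $x_1$ with $x_1\sim x$ and $x_1\sim y$. $D(x)=\max_{y:\,y\sim x}d_y$. *)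

(* Defs.v *)
From HB Require Import structures.
From mathcomp Require Import all_boot all_order all_algebra finmap.
From mathcomp Require Import all_classical reals.

Set Implicit Arguments.
Unset Strict Implicit.
Unset Printing Implicit Defensive.

Import Order.TTheory GRing.Theory Num.Theory.
Local Open Scope classical_set_scope.
Local Open Scope ring_scope.

Record graph (V : choiceType) := Graph {
  adj :> rel V;
  adj_sym : symmetric adj;
  adj_irr : irreflexive adj;
  adj_connected : forall x y, exists2 p, path adj x p & last x p = y }.

Definition locally_finite (V : choiceType) (G : graph V) :=
  forall x, finite_set [set y | G x y].

(* [fset_set] sends every infinite set to [fset0], so everything built on
   [nbrs] is meaningful only when [G] is locally finite. *)
Definition nbrs (V : choiceType) (G : graph V) (x : V) : {fset V} :=
  fset_set [set y | G x y].

Definition deg (V : choiceType) (G : graph V) (x : V) : nat := #|` nbrs G x|.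

Definition triangles (V : choiceType) (G : graph V) (x y : V) : nat :=
  #|` (nbrs G x `&` nbrs G y)%fset|.

Definition maxdeg (V : choiceType) (G : graph V) (x : V) : nat :=
  \max_(y <- nbrs G x) deg G y.

Section Operators.
Context (R : realType) (V : choiceType) (G : graph V).
Implicit Types f g : V -> R.

(* At the vertex of the one-vertex graph the degree is 0, and [0^-1 = 0] makes
   all three operators vanish there. *)
Definition laplacian f (x : V) : R :=
  (deg G x)%:R^-1 * \sum_(y <- nbrs G x) (f y - f x).

Definition Gamma f g (x : V) : R :=
  2^-1 * (laplacian (f \* g) x - f x * laplacian g x - g x * laplacian f x).

Definition Gamma2 f g (x : V) : R :=
  2^-1 * (laplacian (Gamma f g) x
          - Gamma f (laplacian g) x - Gamma (laplacian f) g x).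

End Operators.

(* The infimum over the neighbors is a minimum as soon as there is a neighbor:
   see [tmin_attained] and [tmin_le]; on the one-vertex graph it is
   [inf set0 = 0]. *)
Definition tmin (R : realType) (V : choiceType) (G : graph V) (x : V) : R :=
  inf [set 4 / (deg G y)%:R + (maxdeg G x)%:R^-1 * (triangles G x y)%:R
      | y in [set y | G x y]].

Lemma mem_nbrs (V : choiceType) (G : graph V) (x y : V) :
  locally_finite G -> (y \in nbrs G x) = G x y.
Proof.
move=> Gfin; rewrite /nbrs in_fset_set; last exact: Gfin.
by apply/idP/idP; rewrite inE.
Qed.

Lemma tmin_le (R : realType) (V : choiceType) (G : graph V) (x y : V) :
  G x y ->
  tmin R G x <=
    4 / (deg G y)%:R + (maxdeg G x)%:R^-1 * (triangles G x y)%:R.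
Proof.
move=> xy; apply: ge_inf; last by exists y.
by exists 0 => _ [z _ <-]; rewrite addr_ge0 ?mulr_ge0 ?invr_ge0.
Qed.

Lemma tmin_attained (R : realType) (V : choiceType) (G : graph V) (x y0 : V) :
  locally_finite G -> G x y0 ->
  exists2 y, G x y &
    tmin R G x = 4 / (deg G y)%:R + (maxdeg G x)%:R^-1 * (triangles G x y)%:R.
Proof.
move=> Gfin xy0.
pose F y : R := 4 / (deg G y)%:R + (maxdeg G x)%:R^-1 * (triangles G x y)%:R.
have y0N : y0 \in nbrs G x by rewrite mem_nbrs.
pose m := [arg min_(i < [` y0N]%fset) F (val i)]%O.
have mle y : G x y -> F (val m) <= F y.
  rewrite -(mem_nbrs x y Gfin) => yN; rewrite /m.
  by case: Order.TotalTheory.arg_minP => // i _ /(_ [` yN]%fset isT).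
have xm : G x (val m) by rewrite -(mem_nbrs x _ Gfin); exact: valP.
exists (val m) => //; apply/eqP; rewrite eq_le tmin_le//=.
apply: lb_le_inf; first by exists (F y0), y0.
by move=> _ [y xy <-]; exact: mle.
Qed.

(* Main.v *)
Require Import Defs.
From HB Require Import structures.
From mathcomp Require Import all_boot all_order all_algebra finmap.
From mathcomp Require Import all_classical reals.
From mathcomp Require Import ring.

Set Implicit Arguments.
Unset Strict Implicit.
Unset Printing Implicit Defensive.

Import Order.TTheory GRing.Theory Num.Theory.
Local Open Scope classical_set_scope.
Local Open Scope ring_scope.

(** Both sides are compared through a Bochner formula: for every [f],
    [Gamma2 f f x] equals
    [4^-1 * (mean over y ~ x of the mean over z ~ y of (f x - 2 f y + f z)^2)
     + 2^-1 * (laplacian f x)^2 - Gamma f f x]  (lemma [bochner]).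
    Since [2 * Gamma f f x] is the mean of [(f y - f x)^2] over [y ~ x], the
    theorem reduces to bounding the sum of the squared second differences from
    below by [tmin] times the sum of the squared increments [u y = f y - f x]
    (lemma [sum_second_diff_ge]).

    In terms of [u], a second difference is [u z - 2 * u y].  Among the
    neighbors [z] of [y], keep only [x] itself and the common neighbors of [x]
    and [y].  The term [z = x] has [u x = 0] and yields [4 / d_y * (u y)^2].
    For the triangles, replace the weight [1 / d_y] by the uniform lower bound
    [1 / D x]; the terms of [(y, z)] and [(z, y)] can then be paired, and
    [(u z - 2 u y)^2 + (u y - 2 u z)^2
     = (u y)^2 + (u z)^2 + 4 (u y - u z)^2],
    so that each vertex [y] collects at least [(u y)^2 / D x] for each of its
    triangles (lemma [triangle_energy]).  Altogether the coefficient of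
    [(u y)^2] is the quantity whose minimum over [y] is [tmin]. *)

Section Bochner.
Context (R : realType) (V : choiceType) (G : graph V).
Hypothesis Gfin : locally_finite G.
Implicit Types (f g u : V -> R) (x y z : V).

Lemma deg_gt0 x y : G x y -> (0 < deg G y)%N.
Proof.
by rewrite adj_sym -(mem_nbrs _ _ Gfin) cardfs_gt0 => xN; apply/fset0Pn; exists x.
Qed.

Lemma sum_nbrs_const x (c : R) :
  \sum_(y <- nbrs G x) c = (deg G x)%:R * c.
Proof. by rewrite big_const_seq count_predT iter_addr_0 mulr_natl. Qed.

Lemma GammaE f g x :
  Gamma G f g x =
    2^-1 * ((deg G x)%:R^-1 *
            \sum_(y <- nbrs G x) (f y - f x) * (g y - g x)).
Proof.
rewrite /Gamma /laplacian; congr (_ * _).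
rewrite !(mulrCA _ (deg G x)%:R^-1) -!mulrBr; congr (_ * _).
rewrite !mulr_sumr -!sumrB; apply: eq_bigr => y _ /=; ring.
Qed.

Lemma double_Gamma f g x :
  2 * Gamma G f g x =
    (deg G x)%:R^-1 * \sum_(y <- nbrs G x) (f y - f x) * (g y - g x).
Proof. by rewrite GammaE mulVKf // pnatr_eq0. Qed.

(** Averaging a constant over the neighbors of an isolated vertex gives 0, so
    this needs [Gamma f g x] itself to vanish there. *)
Lemma mean_Gamma f g x :
  (deg G x)%:R^-1 * ((deg G x)%:R * Gamma G f g x) = Gamma G f g x.
Proof.
rewrite GammaE; have [->|d0] := eqVneq (deg G x) 0%N.
  by rewrite invr0 !mul0r mulr0.
by rewrite mulKf // pnatr_eq0.
Qed.

(** The square [(f x - 2 f y + f z)^2] comes from completing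
    [(f z - f y)^2 - 2 (f y - f x) (f z - f y)], where the first part is
    contributed by the Laplacian of [Gamma f f] and the second by
    [Gamma f (laplacian f)]; completing it costs one [Gamma f f x]. *)
Lemma bochner f x :
  Gamma2 G f f x =
    4^-1 * ((deg G x)%:R^-1 * \sum_(y <- nbrs G x) ((deg G y)%:R^-1 *
              \sum_(z <- nbrs G y) (f x - 2 * f y + f z) ^+ 2))
    + 2^-1 * (laplacian G f x) ^+ 2 - Gamma G f f x.
Proof.
have GammaC : Gamma G (laplacian G f) f x = Gamma G f (laplacian G f) x.
  by rewrite !GammaE; under eq_bigr do rewrite mulrC.
have lapGamma : laplacian G (Gamma G f f) x =
    (deg G x)%:R^-1 * \sum_(y <- nbrs G x) Gamma G f f y - Gamma G f f x.
  by rewrite {1}/laplacian sumrB sum_nbrs_const mulrBr mean_Gamma.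
have Gammalap : 2 * Gamma G f (laplacian G f) x =
    (deg G x)%:R^-1 * \sum_(y <- nbrs G x) (f y - f x) * laplacian G f y
    - (laplacian G f x) ^+ 2.
  rewrite double_Gamma.
  under eq_bigr do rewrite mulrBr.
  by rewrite sumrB -mulr_suml mulrBr mulrA -expr2.
have sumsq : 2 * Gamma G f f x =
    (deg G x)%:R^-1 * \sum_(y <- nbrs G x) (f y - f x) ^+ 2.
  exact: double_Gamma.
have square y : y \in nbrs G x ->
    (deg G y)%:R^-1 * \sum_(z <- nbrs G y) (f x - 2 * f y + f z) ^+ 2 =
    2 * Gamma G f f y - 2 * ((f y - f x) * laplacian G f y) + (f y - f x) ^+ 2.
  rewrite mem_nbrs // => /deg_gt0; rewrite lt0n => dy.
  have -> : (f y - f x) ^+ 2 = (deg G y)%:R^-1 * \sum_(z <- nbrs G y) (f y - f x) ^+ 2.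
    by rewrite sum_nbrs_const mulKf // pnatr_eq0.
  rewrite double_Gamma /laplacian.
  rewrite !(mulrCA _ (deg G y)%:R^-1) -mulrBr -mulrDr; congr (_ * _).
  rewrite !mulr_sumr -sumrB -big_split; apply: eq_bigr => z _ /=; ring.
rewrite (eq_big_seq _ square) big_split sumrB /= -!(mulr_sumr _ _ _ 2).
rewrite mulrDr mulrBr -sumsq.
rewrite /Gamma2 GammaC lapGamma.
move: Gammalap; set a := laplacian G f x; set b := Gamma G f (laplacian G f) x.
set c := \sum_(i <- _) _; set d := \sum_(i <- _) _; set e := _^-1.
move=> Gammalap; have -> : b = 2^-1 * (e * c - a ^+ 2).
  by rewrite -Gammalap; field.
by field.
Qed.

End Bochner.

Section TriangleEnergy.
Context (R : realDomainType) (T : Type).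

(** Exchanging the roles of [y] and [z] turns the sum of [(u z)^2 - (u y)^2]
    over related pairs into its opposite, so it vanishes; what remains of
    [(u z - 2 u y)^2 - (u y)^2] is [2 (u y - u z)^2]. *)
Lemma triangle_energy (e : rel T) (s : seq T) (u : T -> R) :
  symmetric e ->
  \sum_(y <- s) \sum_(z <- s | e y z) u y ^+ 2 <=
  \sum_(y <- s) \sum_(z <- s | e y z) (u z - 2 * u y) ^+ 2.
Proof.
move=> e_sym; pose S F : R := \sum_(y <- s) \sum_(z <- s | e y z) F y z.
have swap : S (fun y _ => u y ^+ 2) = S (fun _ z => u z ^+ 2).
  rewrite /S [LHS](exchange_big_dep predT) //=.
  by apply: eq_bigr => y _; apply: eq_bigl => z; rewrite e_sym.
suff -> : \sum_(y <- s) \sum_(z <- s | e y z) (u z - 2 * u y) ^+ 2 =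
    S (fun y z => 2 * (u y - u z) ^+ 2)
    + (S (fun y _ => u y ^+ 2) + S (fun y _ => u y ^+ 2) - S (fun _ z => u z ^+ 2)).
  rewrite -swap addrK lerDr.
  by do 2![apply: sumr_ge0 => ? _]; rewrite mulr_ge0 ?sqr_ge0.
rewrite /S -sumrN -!big_split; apply: eq_bigr => y _ /=.
rewrite -sumrN -!big_split; apply: eq_bigr => z _ /=; ring.
Qed.

End TriangleEnergy.

Section SecondDifferences.
Context (R : realType) (V : choiceType) (G : graph V).
Hypothesis Gfin : locally_finite G.
Implicit Types (u h : V -> R) (x y z : V).

Lemma sum_common_nbrs x y h :
  \sum_(z <- (nbrs G x `&` nbrs G y)%fset) h z =
  \sum_(z <- nbrs G x | G y z) h z.
Proof.
rewrite -[RHS]big_filter; apply: perm_big; apply: uniq_perm.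
- exact: fset_uniq.
- by rewrite filter_uniq // fset_uniq.
- by move=> z; rewrite in_fsetI mem_filter !mem_nbrs // andbC.
Qed.

(** The term at [x] is not counted twice on the left: [x] is not adjacent to
    itself, so it is not a common neighbor of [x] and [y]. *)
Lemma sum_nbrs_ge x y h : G x y -> (forall z, 0 <= h z) ->
  h x + \sum_(z <- nbrs G x | G y z) h z <= \sum_(z <- nbrs G y) h z.
Proof.
move=> xy h_ge0; rewrite -sum_common_nbrs fsetIC sum_common_nbrs.
rewrite [leRHS](bigID (G x)) /= [leLHS]addrC lerD2l.
rewrite (big_rem x) /=; last by rewrite mem_nbrs // adj_sym.
by rewrite adj_irr lerDl sumr_ge0.
Qed.

Lemma le_inv_maxdeg x y : G x y ->
  (maxdeg G x)%:R^-1 <= (deg G y)%:R^-1 :> R.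
Proof.
move=> xy; have dy := deg_gt0 Gfin xy.
have dyD : (deg G y <= maxdeg G x)%N.
  by apply: leq_bigmax_seq => //; rewrite mem_nbrs.
by rewrite lef_pV2 ?ler_nat // posrE ltr0n // (leq_trans dy).
Qed.

(** The normalization [u x = 0] makes [u z - 2 * u y] the second difference
    [u x - 2 * u y + u z] along the path [x, y, z], and its value at [z = x]
    is [- 2 * u y]: returning to [x] yields the term [4 / d_y] of [tmin], the
    common neighbors yield the triangle term. *)
Lemma sum_second_diff_ge x u : u x = 0 ->
  tmin R G x * \sum_(y <- nbrs G x) u y ^+ 2 <=
  \sum_(y <- nbrs G x) ((deg G y)%:R^-1 *
     \sum_(z <- nbrs G y) (u z - 2 * u y) ^+ 2).
Proof.
move=> ux0; pose D : R := (maxdeg G x)%:R^-1.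
have D_ge0 : 0 <= D by rewrite invr_ge0.
apply: (@le_trans _ _ (\sum_(y <- nbrs G x) (4 / (deg G y)%:R * u y ^+ 2)
    + D * \sum_(y <- nbrs G x) \sum_(z <- nbrs G x | G y z) u y ^+ 2)).
  (* For each [y], the inner sum is [triangles G x y] copies of [(u y)^2]. *)
  rewrite !mulr_sumr -big_split /=.
  rewrite !(big_seq_cond (fun _ => true)); apply: ler_sum => y /andP[+ _].
  rewrite mem_nbrs // => xy; rewrite -sum_common_nbrs big_const_seq count_predT.
  rewrite iter_addr_0 -[_ ^+ 2 *+ _]mulr_natl [D * _]mulrA -mulrDl.
  by rewrite ler_wpM2r ?sqr_ge0 // tmin_le.
apply: (@le_trans _ _ (\sum_(y <- nbrs G x) (4 / (deg G y)%:R * u y ^+ 2)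
    + D * \sum_(y <- nbrs G x) \sum_(z <- nbrs G x | G y z)
                                 (u z - 2 * u y) ^+ 2)).
  by rewrite lerD2l ler_wpM2l //; apply: triangle_energy; exact: adj_sym.
rewrite mulr_sumr -big_split /=.
rewrite !(big_seq_cond (fun _ => true)); apply: ler_sum => y /andP[+ _].
rewrite mem_nbrs // => xy.
apply: le_trans (ler_wpM2l _ (@sum_nbrs_ge x y
  (fun z => (u z - 2 * u y) ^+ 2) xy _)); rewrite ?invr_ge0 //; last first.
  by move=> z; exact: sqr_ge0.
rewrite mulrDr lerD //; last first.
  by rewrite ler_wpM2r ?le_inv_maxdeg // sumr_ge0 // => z _; exact: sqr_ge0.
by rewrite ux0 le_eqVlt; apply/orP; left; apply/eqP; ring.
Qed.

End SecondDifferences.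

Theorem theorem9 (R : realType) (V : choiceType) (G : graph V)
    (Gfin : locally_finite G) (f : V -> R) (x : V) :
  Gamma2 G f f x >=
    2^-1 * (laplacian G f x) ^+ 2
    + (2^-1 * tmin R G x - 1) * Gamma G f f x.
Proof.
pose u y := f y - f x.
have second_diff y z : f x - 2 * f y + f z = u z - 2 * u y by rewrite /u; ring.
rewrite bochner // mulrBl mul1r addrA lerD2r addrC lerD2r.
under [X in _ <= 4^-1 * (_ * X)]eq_bigr do
  under eq_bigr do rewrite second_diff.
have -> : 2^-1 * tmin R G x * Gamma G f f x =
    4^-1 * ((deg G x)%:R^-1 * (tmin R G x * \sum_(y <- nbrs G x) u y ^+ 2)).
  rewrite GammaE; under eq_bigr do rewrite -expr2.
  by set w := (deg G x)%:R^-1; field.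
by rewrite !ler_wpM2l ?invr_ge0 ?sum_second_diff_ge // /u subrr.
Qed.
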